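(* Let $\zeta$ be a nonnegative random variable with Laplace–Stieltjes transform $\psi(\alpha)\equiv\mathbb{E}e^{-\alpha\zeta}=\alpha\varphi'(0+)/\varphi(\alpha)$, $\alpha>0$, where $\varphi$ is the Laplace exponent described in the context. For $i\in\{1,2,\ldots\}$ denote $\eta_i\equiv\int_{(0,\infty)}y^i\,\nu(\mathrm{d}y)$. Let $k\in\{1,2,\ldots\}$. If $\eta_k<\infty$, then $$(-1)^k\,\mathbb{E}\zeta^k=\psi_k=-\frac{1}{(k+1)\varphi_1}\sum_{i=0}^{k-1}\binom{k+1}{i}\psi_i\,\varphi_{k+1-i}.$$ Otherwise (i.e. if $\eta_k=\infty$), $\mathbb{E}\zeta^k=(-1)^k\psi_k=\infty$.
   Context: $J(\cdot)$ is a Lévy process that is the superposition of a subordinator and an independent drifted Brownian motion; its Laplace exponent is $$\varphi(\alpha)\equiv-\log\mathbb{E}e^{-\alpha J(1)}=c\alpha-\frac{\sigma^2\alpha^2}{2}-\int_{(0,\infty)}(e^{-\alpha y}-1)\,\nu(\mathrm{d}y),\qquad \alpha\ge0,$$ where $c\in\mathbb{R}$, $\sigma\ge0$ and $\nu$ is a Borel measure on $(0,\infty)$ with $\int_{(0,\infty)}(1\wedge y)\,\nu(\mathrm{d}y)<\infty$. Standing assumption: $\varrho\equiv\mathbb{E}J(1)=\varphi'(0+)=c+\int_{(0,\infty)}y\,\nu(\mathrm{d}y)$ is finite and negative. For $k\in\{0,1,2,\ldots\}$, $\psi_k\equiv\lim_{\alpha\downarrow0}\psi^{(k)}(\alpha)$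 and $\varphi_k\equiv\lim_{\alpha\downarrow0}\varphi^{(k)}(\alpha)$ ($k$-th derivatives); these limits may be infinite, and the identity is then understood in the extended reals. In particular $\psi_0=1$, $\varphi_1=\varrho$, $\varphi_2=-(\sigma^2+\eta_2)$ and $\varphi_i=(-1)^{i+1}\eta_i$ for $i\ge3$. *)

(* Defs.v *)
From mathcomp Require Import all_boot all_order all_algebra.
From mathcomp Require Import all_classical all_reals all_analysis.

Set Implicit Arguments.
Unset Strict Implicit.
Unset Printing Implicit Defensive.

Import Order.TTheory GRing.Theory Num.Theory.
Import numFieldNormedType.Exports.

Local Open Scope classical_set_scope.
Local Open Scope ring_scope.

(* Stochastic processes are families X : R -> {RV P >-> R}; the time set is
   [0, +oo[, and nothing is ever asked of X t for t < 0. *)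

Section processes.
Context {d : measure_display} {T : measurableType d} {R : realType}.
Variable P : probability T R.
Implicit Types X Y : R -> {RV P >-> R}.

Definition increment X (s t : R) : T -> R := fun w => X t w - X s w.

(* The product rule for the whole family of n increments gives mutual
   independence: subfamilies are obtained by taking some A i to be setT. *)
Definition independent_increments X : Prop :=
  forall (n : nat) (t : nat -> R) (A : 'I_n -> set R),
    0 <= t 0%N -> {homo t : i j / (i <= j)%N >-> i <= j} ->
    (forall i, measurable (A i)) ->
    P (\bigcap_(i in [set: 'I_n]) (increment X (t i) (t i.+1) @^-1` A i)) =
    (\prod_(i < n) P (increment X (t i) (t i.+1) @^-1` A i))%E.

Definition stationary_increments X : Prop :=
  forall (s t : R) (A : set R), 0 <= s -> s <= t -> measurable A ->
    P (increment X s t @^-1` A) = P (X (t - s) @^-1` A).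

Definition cadlag (f : R -> R) : Prop :=
  (forall t, 0 <= t -> f x @[x --> t^'+] --> f t) /\
  (forall t, 0 < t -> cvg (f x @[x --> t^'-])).

Definition levy_process X : Prop :=
  [/\ {ae P, forall w, X 0 w = 0},
      independent_increments X,
      stationary_increments X &
      {ae P, forall w, cadlag (fun t => X t w)}].

Definition subordinator X : Prop :=
  levy_process X /\
  {ae P, forall w, forall s t, 0 <= s -> s <= t -> X s w <= X t w}.

(* X t = m t + sigma B t in law, with B a standard Brownian motion. The normal
   law is pushed forward from N(0, 1), so that sigma = 0 (deterministic drift)
   and t = 0 are covered: normal_prob is not a Dirac mass at deviation 0. *)
Definition drifted_brownian_motion (m sigma : R) X : Prop :=
  [/\ levy_process X,
      forall (t : R) (A : set R), 0 <= t -> measurable A ->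
        P (X t @^-1` A) =
        normal_prob 0 1
          ((fun x : R => m * t + sigma * Num.sqrt t * x) @^-1` A) &
      {ae P, forall w, {within `[0, +oo[, continuous (fun t => X t w)}}].

(* Independence of the generated sigma-algebras, stated on the generating
   pi-systems of finite-dimensional cylinders. *)
Definition independent_processes X Y : Prop :=
  forall (m n : nat) (s : 'I_m -> R) (t : 'I_n -> R)
         (A : 'I_m -> set R) (B : 'I_n -> set R),
    (forall i, 0 <= s i) -> (forall j, 0 <= t j) ->
    (forall i, measurable (A i)) -> (forall j, measurable (B j)) ->
    let EX := \bigcap_(i in [set: 'I_m]) (X (s i) @^-1` A i) in
    let EY := \bigcap_(j in [set: 'I_n]) (Y (t j) @^-1` B j) in
    P (EX `&` EY) = (P EX * P EY)%E.

Definition subordinator_plus_brownian (sigma : R) X : Prop :=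
  levy_process X /\
  exists (S W : R -> {RV P >-> R}) (m : R),
    [/\ subordinator S,
        drifted_brownian_motion m sigma W,
        independent_processes S W &
        forall t w, 0 <= t -> X t w = S t w + W t w].

(* 'M_P X (- a) is E[exp(- a X)]. *)
Definition laplace_transform (X : {RV P >-> R}) (a : R) : R :=
  fine ('M_P X (- a)).

Definition laplace_exponent X (a : R) : R :=
  - ln (laplace_transform (X 1) a).

End processes.

(* The measure nu on ]0, +oo[ is represented by a measure on the Borel sets of
   R that is only ever integrated over ]0, +oo[. *)
Definition levy_moment {R : realType}
    (nu : {measure set (measurableTypeR R) -> \bar R}) (i : nat) : \bar R :=
  (\int[nu]_(y in `]0%R, +oo[) (y ^+ i)%:E)%E.

(* The limit is taken in \bar R, so it may be infinite; only derivatives at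
   points a > 0 are involved. *)
Definition deriv_lim0 {R : realType} (f : R -> R) (k : nat) : \bar R :=
  lim ((derive1n k f a)%:E @[a --> 0^'+]).

(* Main.v *)
Require Import Defs.
From mathcomp Require Import all_boot all_order all_algebra.
From mathcomp Require Import all_classical all_reals all_analysis.
From mathcomp Require Import measurable_realfun ring lra.

Set Implicit Arguments.
Unset Strict Implicit.
Unset Printing Implicit Defensive.

Import Order.TTheory GRing.Theory Num.Theory.
Import numFieldNormedType.Exports.

Local Open Scope classical_set_scope.
Local Open Scope ring_scope.

(** Write [phi] for the Laplace exponent and [psi] for the transform of [zeta].
The relation [psi a = a * rho / phi a] says that [psi] times [g] is the constant
[rho] on the open half-line, where [g a = phi a / a].  Differentiating this
product [k >= 1] times gives, at every [a > 0],
[[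
  - psi^(k) g = \sum_(i < k) 'C(k, i) psi^(i) g^(k - i),
]]
and the recursion is the limit of this identity as [a] decreases to 0, once two
facts are known: [g^(j)] tends to [phi_(j+1) / (j+1)], and
['C(k, i) * (k+1) = 'C(k+1, i) * (k+1-i)].  Dividing by [a] before
differentiating is what makes the passage to the limit immediate: the product
[psi * phi] would bring in the term [psi^(k+1) phi], whose limit may be of the
form infinity times 0.

Up to a polynomial, [psi] and [phi] are integrals of [expR (- (a * f x))], or of
[expR (- (a * f x)) - 1] in the case of [phi].  For [a > 0] such an integral can
be differentiated under the integral sign ([derivative_tower_laplace]), and by
monotone convergence its [n]-th derivative, [n >= 1], tends to the signed [n]-th
moment of [f], finite or not ([cvg_laplace_tower]).  This gives
[psi_k = (-1)^k E zeta^k] and expresses [phi_j] through [eta_j].  The limit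
of [g^(j)] is a case of L'Hopital's rule
([cvg_quotient_tower]), which holds for infinite limits as well: the derivative
of [a^(j+1) g^(j)] is [a^j phi^(j+1)], while that of [a^(j+1)] is [(j+1) a^j].

In the limit ([moment_recursion]) the only possibly infinite term of the sum is
the one for [i = 0], namely [phi_(k+1)], because the others only involve
[phi_2, ..., phi_k].  Hence, as long as the previous quantities are finite,
[psi_k] is finite exactly when [phi_(k+1)] is ([moment_recursion_fin]).  By
induction, finiteness of [eta_k] gives that of [psi_i] for all [i < k]
([fin_num_moment]), so the recursion applies to [psi_k].  Conversely, if
[E zeta^k] were finite then so would be all lower moments of [zeta], and then
[eta_k] ([fin_num_exponent]); this settles the case [eta_k = +oo]. *)

(** * Functions with all their derivatives on the open half-line *)

Section derivative_towers.
Context {R : realType}.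
Implicit Types (u v : nat -> R -> R) (F : R -> R).

(** Derivatives are asked for at [a > 0] only: the functions of interest are
smooth there, whereas at 0 their derivatives may become infinite. *)
Definition derivative_tower u : Prop :=
  forall n (a : R), 0 < a -> is_derive a 1 (u n) (u n.+1 a).

Lemma derive1n_tower u F : derivative_tower u ->
  (forall a, 0 < a -> F a = u 0%N a) ->
  forall n a, 0 < a -> derive1n n F a = u n a.
Proof.
move=> du Fu; elim=> [|n IH] a a0; first exact: Fu.
rewrite derive1nS derive1E (@near_eq_derive _ _ _ _ (u n)).
  by have := du n a a0 => ?; exact: derive_val.
by near=> t; apply: IH; near: t; exact: lt_nbhsr.
Unshelve. all: by end_near. Qed.

Lemma deriv_lim0_tower u F n (l : \bar R) : derivative_tower u ->
  (forall a, 0 < a -> F a = u 0%N a) ->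
  (u n a)%:E @[a --> 0^'+] --> l -> deriv_lim0 F n = l.
Proof.
move=> du Fu ul; apply/cvg_lim => //; apply: cvg_trans ul; apply: near_eq_cvg.
near=> a; congr (_%:E); apply/esym/derive1n_tower => //.
Unshelve. all: by end_near. Qed.

(** The successive derivatives of [u 0 * v 0], by the product rule. *)
Definition leibniz_tower u v n a : R :=
  \sum_(i < n.+1) 'C(n, i)%:R * u i a * v (n - i)%N a.

Lemma derivative_tower_leibniz u v :
  derivative_tower u -> derivative_tower v ->
  derivative_tower (leibniz_tower u v).
Proof.
move=> du dv n a a0; rewrite /leibniz_tower.
have -> : (fun x => \sum_(i < n.+1) 'C(n, i)%:R * u i x * v (n - i)%N x) =
    \sum_(i < n.+1) (fun x => 'C(n, i)%:R * u i x * v (n - i)%N x).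
  by apply/funext => x; rewrite fct_sumE.
pose D (i : 'I_n.+1) : R := 'C(n, i)%:R * u i.+1 a * v (n - i)%N a +
  'C(n, i)%:R * u i a * v (n - i).+1 a.
have dD (i : 'I_n.+1) :
    is_derive a 1 (fun x => 'C(n, i)%:R * u i x * v (n - i)%N x) (D i).
  have ? := du i a a0; have ? := dv (n - i)%N a a0.
  apply: is_derive_eq; rewrite /D /GRing.scale /=; ring.
apply: is_derive_eq; rewrite {dD}/D big_split/=.
(* Pascal's rule splits the target sum into the two sums just obtained. *)
rewrite [RHS]big_ord_recl /= bin0 subn0.
under [in RHS]eq_bigr => i _ do
  rewrite /bump leq0n add1n subSS binS natrD !mulrDl.
rewrite big_split/= addrA [RHS]addrC; congr (_ + _).
rewrite [LHS]big_ord_recl /= bin0 subn0; congr (_ + _).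
rewrite [RHS]big_ord_recr /= bin_small// !mul0r addr0.
apply: eq_bigr => i _.
by rewrite /bump leq0n add1n subnSK.
Qed.

Lemma leibniz_tower_cst u v (c : R) :
  derivative_tower u -> derivative_tower v ->
  (forall a, 0 < a -> u 0%N a * v 0%N a = c) ->
  forall n a, 0 < a -> leibniz_tower u v n.+1 a = 0.
Proof.
move=> du dv uvc n a a0.
have dw := derivative_tower_leibniz du dv.
pose w n (_ : R) : R := if n is 0%N then c else 0.
have dwc : derivative_tower w.
  by move=> [|m] t t0; rewrite /w; exact: is_derive_cst.
rewrite -(derive1n_tower dw (F := leibniz_tower u v 0))//.
rewrite (derive1n_tower dwc)// => t t0.
by rewrite /leibniz_tower big_ord1 bin0 mul1r subnn uvc.
Qed.

(** The successive derivatives of [fun a => u 0 a / a]: if [h] is the quotient,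
differentiating [a * h a = u 0 a] gives [a * h^(n+1) + (n+1) * h^(n) = u (n+1)],
which is solved for [h^(n+1)]. *)
Fixpoint quotient_tower u n a : R :=
  (if n is m.+1 then u n a - n%:R * quotient_tower u m a else u 0%N a) / a.

Lemma quotient_towerS u n a :
  quotient_tower u n.+1 a = (u n.+1 a - n.+1%:R * quotient_tower u n a) / a.
Proof. by []. Qed.

Lemma is_derive_exprn n (a : R) :
  is_derive a 1 (fun t => t ^+ n.+1) (n.+1%:R * a ^+ n).
Proof.
rewrite (_ : (fun t => _) = (id : R -> R) ^+ n.+1); last first.
  by apply/funext => t; rewrite exprfctE.
by apply: is_derive_eq; rewrite /GRing.scale/= mulr1.
Qed.

Lemma is_derive_divx (f : R -> R) (df a : R) : a != 0 -> is_derive a 1 f df ->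
  is_derive a 1 (fun t => f t / t) ((df - f a / a) / a).
Proof.
move=> a0 dfa; have ? := @is_deriveV R id a 1 1 a0 (is_derive_id _ _).
by apply: is_derive_eq; rewrite /GRing.scale /=; field.
Qed.

Lemma derivative_tower_quotient u :
  derivative_tower u -> derivative_tower (quotient_tower u).
Proof.
move=> du; elim=> [|n IH] a a0; have an0 : a != 0 by rewrite gt_eqF.
  have ? := du 0%N a a0; rewrite /= mul1r.
  exact: is_derive_divx.
have dun := du n.+1 a a0; have dqn := IH a a0.
have dn : is_derive a 1 (fun t => u n.+1 t - n.+1%:R * quotient_tower u n t)
    (u n.+2 a - n.+1%:R * quotient_tower u n.+1 a).
  exact: is_derive_eq.
have := is_derive_divx an0 dn; rewrite -quotient_towerS => dq.
apply: is_derive_eq; rewrite [RHS]quotient_towerS; congr (_ / _).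
by rewrite -addrA -opprD -{2}[quotient_tower _ _ _]mul1r -mulrDl natr1.
Qed.

(** The relation defining [quotient_tower], multiplied by [a ^+ n], is the
product rule for [a ^+ n.+1 * h^(n)]. *)
Lemma is_derive_exprM_quotient u n (a : R) : derivative_tower u -> 0 < a ->
  is_derive a 1 (fun t => t ^+ n.+1 * quotient_tower u n t) (a ^+ n * u n.+1 a).
Proof.
move=> du a0; have dq := derivative_tower_quotient du n a0.
apply: is_derive_eq (is_deriveM (is_derive_exprn n a) dq) _.
rewrite /GRing.scale /= exprS.
have an0 : a != 0 by rewrite gt_eqF.
by field.
Qed.

(** Unfolding the recursion, [a ^+ n.+1 * h^(n)] is a combination of the
[a ^+ i * u i a] with [i <= n]. *)
Lemma cvg_exprM_quotient u n :
  (forall i, (i <= n)%N -> a ^+ i * u i a @[a --> 0^'+] --> 0) ->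
  a ^+ n.+1 * quotient_tower u n a @[a --> 0^'+] --> 0.
Proof.
elim: n => [|n IH] u_small.
  have := u_small 0%N (leqnn 0%N).
  apply: cvg_trans; apply: near_eq_cvg; near=> a.
  by rewrite /= expr0 expr1 mul1r mulrC divfK// gt_eqF.
have c0 := IH (fun i i_n => u_small i (leq_trans i_n (leqnSn n))).
have c1 : n.+1%:R * (a ^+ n.+1 * quotient_tower u n a) @[a --> 0^'+] -->
    n.+1%:R * (0 : R).
  by apply: cvgM => //; exact: cvg_cst.
have /cvgB/(_ c1) := u_small n.+1 (leqnn _).
rewrite mulr0 subr0; apply: cvg_trans; apply: near_eq_cvg; near=> a.
rewrite fctE quotient_towerS [X in _ = X * _]exprSr.
have an0 : a != 0 by rewrite gt_eqF.
by rewrite opprfctE; field.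
Unshelve. all: by end_near. Qed.

(** L'Hopital's rule for [a ^+ n.+1 * h^(n)] against [a ^+ n.+1], where [l] may
be infinite. Cauchy's mean value theorem on [`[0, a]] yields a point [xi] of
[`]0, a[] at which [u n.+1] takes exactly the value [n.+1%:R * h^(n) a]. *)
Lemma cvg_quotient_tower u n (l : \bar R) : derivative_tower u ->
  (forall i, (i <= n)%N -> a ^+ i * u i a @[a --> 0^'+] --> 0) ->
  (u n.+1 a)%:E @[a --> 0^'+] --> l ->
  (n.+1%:R * quotient_tower u n a)%:E @[a --> 0^'+] --> l.
Proof.
move=> du u_small ul.
have xi_ex (a : R) : exists xi : R,
    0 < a -> 0 < xi < a /\ n.+1%:R * quotient_tower u n a = u n.+1 xi.
  have [a0|a0] := ltP 0 a; last by exists 0.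
  pose f (t : R) := t ^+ n.+1 * quotient_tower u n t.
  (* [quotient_tower u n 0] is a junk value, but the factor [0 ^+ n.+1] kills
     it, so [f] is already the continuous extension to 0. *)
  have f0 : f 0 = 0 by rewrite /f expr0n mul0r.
  have df (t : R) : 0 < t -> is_derive t 1 f (t ^+ n * u n.+1 t).
    exact: is_derive_exprM_quotient.
  have cf : {within `[0, a], continuous f}.
    have cft (t : R) : 0 < t -> {for t, continuous f}.
      move=> t0; apply: differentiable_continuous; apply/derivable1_diffP.
      by have := df t t0 => ?; exact: ex_derive.
    apply/continuous_within_itvP => //; split.
    - by move=> t; rewrite in_itv/= => /andP[t0 _]; exact: cft.
    - by rewrite f0; exact: cvg_exprM_quotient.
    - by apply: cvg_at_left_filter; exact: cft.
  pose g (t : R) := t ^+ n.+1.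
  have cg : {within `[0, a], continuous g}.
    by apply: continuous_subspaceT => t; exact: exprn_continuous.
  have [||t|xi] := @cauchy_MVT R f (fun t => t ^+ n * u n.+1 t)
      g (fun t => n.+1%:R * t ^+ n) 0 a a0 cf cg.
  - by move=> t; rewrite in_itv/= => /andP[t0 _]; exact: df.
  - by move=> t _; exact: is_derive_exprn.
  - rewrite in_itv/= => /andP[t0 _].
    by rewrite mulf_neq0// ?expf_neq0// gt_eqF.
  rewrite in_itv/= => /andP[xi0 xia].
  rewrite f0 /f /g expr0n /= !subr0 => E; exists xi => _.
  rewrite xi0 xia; split=> //.
  have an0 : a ^+ n.+1 != 0 by rewrite expf_neq0 ?gt_eqF.
  have xn0 : xi ^+ n != 0 by rewrite expf_neq0 ?gt_eqF.
  move: E; rewrite [RHS]mulrAC divff// mul1r => <-.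
  have nn0 : n.+1%:R != 0 :> R by rewrite pnatr_eq0.
  by field; rewrite xn0 addrC natr1 nn0.
have [xi xiP] := choice xi_ex.
have xi_right : xi a @[a --> 0^'+] --> (0 : R)^'+.
  move=> A [e /= e0 eA]; exists e => //= a /= ae a0.
  have [/andP[xi0 xia] _] := xiP a a0.
  apply: eA => //=; move: ae; rewrite !sub0r !normrN !gtr0_norm//.
  exact: lt_trans.
have := cvg_trans (cvg_app (fun x => (u n.+1 x)%:E) xi_right) ul.
apply: cvg_trans; apply: near_eq_cvg; near=> a => /=.
by rewrite (xiP a _).2.
Unshelve. all: by end_near. Qed.

End derivative_towers.

(** * Laplace transforms and their moments *)

Section laplace_integrals.
Context {d : measure_display} {X : measurableType d} {R : realType}.
Variables (mu : {measure set X -> \bar R}) (D : set X) (f : X -> R).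
Hypotheses (mD : measurable D) (mf : measurable_fun D f).
Hypothesis f_ge0 : forall x, D x -> 0 <= f x.

(** The constant [b] only enters at order 0.  With [b = 1] the integrand is
[expR (- (a * f x)) - 1], which is integrable as soon as [f] is, even when the
measure is infinite; with [b = 0] one gets an ordinary Laplace transform. *)
Definition laplace_integrand (b : R) (n : nat) (a : R) (x : X) : R :=
  f x ^+ n * expR (- (a * f x)) - (n == 0%N)%:R * b.

Definition laplace_tower (b : R) (n : nat) (a : R) : R :=
  (-1) ^+ n * \int[mu]_(x in D) laplace_integrand b n a x.

Lemma measurable_expRM (a : R) : measurable_fun D (fun x => expR (- (a * f x))).
Proof.
apply: measurableT_comp => //; apply: measurableT_comp => //.
exact: measurable_funM.
Qed.

Lemma measurable_exprM_expR (n : nat) (a : R) :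
  measurable_fun D (fun x => f x ^+ n * expR (- (a * f x))).
Proof.
apply: measurable_funM; last exact: measurable_expRM.
exact: measurable_funX.
Qed.

Lemma measurable_laplace_integrand (b : R) (n : nat) (a : R) :
  measurable_fun D (laplace_integrand b n a).
Proof. by apply: measurable_funB => //; exact: measurable_exprM_expR. Qed.

(** Differentiation under the integral sign at [a].  On [`]a / 2, a + 1[] the
derivative of the integrand is dominated by its value at [a / 2], since
[f >= 0]. *)
Lemma derivative_tower_laplace (b : R) :
  (forall n (a : R), 0 < a ->
     mu.-integrable D (EFin \o laplace_integrand b n a)) ->
  derivative_tower (laplace_tower b).
Proof.
move=> intF n a a0; rewrite /laplace_tower.
pose F := laplace_integrand b n.
have dF x (t : R) :
    is_derive t 1 (F ^~ x) (- laplace_integrand b n.+1 t x).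
  rewrite /F /laplace_integrand mul0r subr0; apply: is_derive_eq.
  rewrite /GRing.scale /= exprS; ring.
have d1F (t : R) x : partial1of2 F t x = - laplace_integrand b n.+1 t x.
  by rewrite partial1of2E; apply: derive_val.
have Ia : `](a / 2), (a + 1)[%classic a by rewrite /= in_itv /=; lra.
have intFt t : `](a / 2), (a + 1)[%classic t -> mu.-integrable D (EFin \o F t).
  by rewrite /= in_itv /= => t_; apply: intF; lra.
have derF t x : `](a / 2), (a + 1)[%classic t -> D x -> derivable (F ^~ x) t 1.
  by move=> _ _; apply: ex_derive.
pose G x := `|laplace_integrand b n.+1 (a / 2) x|.
have G0 x : 0 <= G x by exact: normr_ge0.
have intG : mu.-integrable D (EFin \o G).
  by apply: integrable_abse (intF n.+1 (a / 2) _); lra.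
have leG t x : `](a / 2), (a + 1)[%classic t -> D x ->
    `|partial1of2 F t x| <= G x.
  rewrite /= in_itv /= => /andP[t1 _] Dx.
  rewrite d1F normrN /G /laplace_integrand mul0r !subr0 !normrM.
  rewrite ler_wpM2l// !ger0_norm ?expR_ge0// ler_expR.
  by rewrite lerN2 ler_wpM2r ?f_ge0// ltW.
have dIF := differentiation_under_integral mD Ia intFt derF G0 intG leG.
have ddIF := derivable_under_integral mD Ia intFt derF G0 intG leG.
have dI : is_derive a 1 (fun t => \int[mu]_(x in D) laplace_integrand b n t x)
    (- \int[mu]_(x in D) laplace_integrand b n.+1 a x).
  apply: DeriveDef; first exact: ddIF.
  rewrite -derive1E dIF; under eq_Rintegral do rewrite d1F -mulN1r.
  by rewrite RintegralZl ?mulN1r//; exact: intF.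
apply: is_derive_eq; rewrite /GRing.scale /= exprS; ring.
Qed.

(** The integral decreases in [a], so its limit at [0^'+] exists and may be
computed along [a = m.+1%:R^-1], where monotone convergence applies. *)
Lemma cvg_laplace_moment (n : nat) :
  (\int[mu]_(x in D) (f x ^+ n * expR (- (a * f x)))%:E)%E @[a --> 0^'+] -->
  (\int[mu]_(x in D) (f x ^+ n)%:E)%E.
Proof.
set F := fun a : R => (\int[mu]_(x in D) (f x ^+ n * expR (- (a * f x)))%:E)%E.
have dF : {in `]0, +oo[ &, nonincreasing_fun F}.
  move=> s t _ _ st; apply: ge0_le_integral => //.
  - by move=> x Dx; rewrite lee_fin mulr_ge0 ?exprn_ge0 ?expR_ge0 ?f_ge0.
  - exact/measurable_EFinP/measurable_exprM_expR.
  - exact/measurable_EFinP/measurable_exprM_expR.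
  - move=> x Dx; rewrite lee_fin ler_wpM2l ?exprn_ge0 ?f_ge0// ler_expR.
    by rewrite lerN2 ler_wpM2r ?f_ge0.
have cF : cvg (F a @[a --> 0^'+]).
  apply/cvg_ex; eexists.
  exact: (@nonincreasing_at_right_cvge R F 0 (BInfty R false) isT dF).
pose u (m : nat) : R := m.+1%:R^-1.
have u_gt0 m : 0 < u m by rewrite invr_gt0.
have u_cvg : u @ \oo --> (0 : R) by exact: cvg_harmonic.
have u_right : u @ \oo --> (0 : R)^'+.
  move=> A [e /= e0 eA]; have /cvgrPdist_lt/(_ _ e0) := u_cvg.
  by apply: filterS => m /= ?; exact: eA.
have Fu : F (u m) @[m --> \oo] --> lim (F a @[a --> 0^'+]).
  exact: cvg_trans (cvg_app F u_right) cF.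
suff Fu' : F (u m) @[m --> \oo] --> (\int[mu]_(x in D) (f x ^+ n)%:E)%E.
  by rewrite -(cvg_unique _ Fu Fu').
have -> : (\int[mu]_(x in D) (f x ^+ n)%:E)%E =
    (\int[mu]_(x in D)
      limn (fun m => (f x ^+ n * expR (- (u m * f x)))%:E))%E.
  apply: eq_integral => x _; apply/esym/cvg_lim => //.
  apply: cvg_EFin; first exact: nearW.
  rewrite /comp /= -[X in _ --> X]mulr1; apply: cvgM; first exact: cvg_cst.
  rewrite -(@expR0 R).
  apply: continuous_cvg; first exact: continuous_expR.
  rewrite -oppr0; apply: cvgN; rewrite -(mul0r (f x)); apply: cvgM => //.
  exact: cvg_cst.
apply: cvg_monotone_convergence => //.
- by move=> m; exact/measurable_EFinP/measurable_exprM_expR.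
- by move=> m x Dx; rewrite lee_fin mulr_ge0 ?exprn_ge0 ?expR_ge0 ?f_ge0.
- move=> x Dx p q pq; rewrite lee_fin ler_wpM2l ?exprn_ge0 ?f_ge0// ler_expR.
  by rewrite lerN2 ler_wpM2r ?f_ge0// lef_pV2 ?posrE// ler_nat.
Qed.

(** The limit is taken in the extended reals because the moments of [f] may be
infinite.  At order 0 a nonzero [b] would have to be subtracted from it; this is
the case excluded by the last hypothesis. *)
Lemma cvg_laplace_tower (b : R) (n : nat) :
  (forall a : R, 0 < a ->
     mu.-integrable D (EFin \o laplace_integrand b n a)) ->
  (n == 0%N)%:R * b = 0 ->
  (laplace_tower b n a)%:E @[a --> 0^'+] -->
  (((-1) ^+ n)%:E * \int[mu]_(x in D) (f x ^+ n)%:E)%E.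
Proof.
move=> intF b0.
have sgnF : ((-1) ^+ n : R)%:E \is a fin_num by [].
have := cvgeZl sgnF (@cvg_laplace_moment n).
apply: cvg_trans; apply: near_eq_cvg; near=> a.
have a0 : 0 < a by [].
rewrite /laplace_tower EFinM /Rintegral fineK; last first.
  by rewrite integrable_fin_num//; exact: intF.
congr (_ * _)%E; apply: eq_integral => x _.
by rewrite /laplace_integrand b0 subr0.
Unshelve. all: by end_near. Qed.

End laplace_integrals.

Section integrability.
Context {d : measure_display} {X : measurableType d} {R : realType}.
Variables (mu : {measure set X -> \bar R}) (D : set X) (f : X -> R).
Hypotheses (mD : measurable D) (mf : measurable_fun D f).
Hypothesis f_ge0 : forall x, D x -> 0 <= f x.

Lemma exprn_expRN_le n (t : R) : 0 <= t -> t ^+ n * expR (- t) <= n`!%:R.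
Proof.
move=> t0; rewrite expRN ler_pdivrMr ?expR_gt0//.
case: n => [|n]; first by rewrite expr0 fact0 mul1r -expR0 ler_expR.
rewrite mulrC -ler_pdivrMr ?ltr0n ?fact_gt0//.
by apply: le_trans (expR_ge1Dxn n t0); rewrite lerDr.
Qed.

(** This one bound yields both the integrability of all the integrands with
[b = 1] and their size as [a] tends to 0. *)
Lemma compensated_exprn_expRN_le n (t : R) : 0 <= t ->
  `|t ^+ n * expR (- t) - (n == 0%N)%:R| <= n.-1`!%:R * t.
Proof.
move=> t0; case: n => [|n] /=.
  rewrite fact0 !mul1r ler0_norm ?subr_le0 ?expR_le1 ?oppr_le0//.
  by rewrite opprB lerBlDr -lerBlDl expR_ge1Dx.
rewrite subr0 ger0_norm ?mulr_ge0 ?exprn_ge0 ?expR_ge0//.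
by rewrite exprSr mulrAC ler_wpM2r// exprn_expRN_le.
Qed.

Lemma laplace_integrand_scale (b : R) n (a : R) x :
  a ^+ n * laplace_integrand f b n a x =
  (a * f x) ^+ n * expR (- (a * f x)) - (n == 0%N)%:R * b.
Proof.
rewrite /laplace_integrand mulrBr exprMn mulrA; congr (_ - _).
by case: n => [|n]; rewrite ?expr0 ?mul1r// !mul0r mulr0.
Qed.

Lemma integrable_laplace_integrand_finite
    (P : {finite_measure set X -> \bar R}) n (a : R) : 0 < a ->
  P.-integrable D (EFin \o laplace_integrand f 0 n a).
Proof.
move=> a0.
apply: (@le_integrable _ _ _ P D mD _ (EFin \o cst (n`!%:R / a ^+ n))).
- exact/measurable_EFinP/measurable_laplace_integrand.
- move=> x Dx; have t0 : 0 <= a * f x by rewrite mulr_ge0 ?f_ge0// ltW.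
  rewrite /= lee_fin /laplace_integrand mulr0 subr0.
  rewrite [leRHS]ger0_norm; last first.
    by rewrite divr_ge0 ?exprn_ge0// ltW.
  rewrite ger0_norm ?mulr_ge0 ?exprn_ge0 ?f_ge0 ?expR_ge0//.
  rewrite ler_pdivlMr ?exprn_gt0// mulrC mulrA -exprMn.
  exact: exprn_expRN_le.
- exact: finite_measure_integrable_cst.
Qed.

Hypothesis f_int : mu.-integrable D (EFin \o f).

Lemma laplace_integrand_le n (a : R) x : 0 < a -> D x ->
  `|a ^+ n * laplace_integrand f 1 n a x| <= n.-1`!%:R * (a * f x).
Proof.
move=> a0 Dx; rewrite laplace_integrand_scale.
by rewrite mulr1 compensated_exprn_expRN_le// mulr_ge0 ?f_ge0// ltW.
Qed.

Lemma integrable_laplace_integrand n (a : R) : 0 < a ->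
  mu.-integrable D (EFin \o laplace_integrand f 1 n a).
Proof.
move=> a0.
apply: (@le_integrable _ _ _ mu D mD _
  (EFin \o (fun x => n.-1`!%:R * a / a ^+ n * f x))).
- exact/measurable_EFinP/measurable_laplace_integrand.
- move=> x Dx; rewrite /= lee_fin [leRHS]ger0_norm; last first.
    by rewrite !(mulr_ge0, divr_ge0, invr_ge0, exprn_ge0, f_ge0) ?(ltW a0).
  rewrite mulrAC ler_pdivlMr ?exprn_gt0// -mulrA.
  rewrite -[X in _ * X](@ger0_norm _ (a ^+ n)) ?exprn_ge0 ?(ltW a0)//.
  by rewrite -normrM [X in `|X|]mulrC laplace_integrand_le.
- exact: (integrableZl mD _ f_int).
Qed.

(** Although the [n]-th derivative may blow up at 0, it does so more slowly than
[a ^- n]: the product is at most [n.-1`!%:R * a] times the integral of [f]. *)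
Lemma cvg_exprM_laplace_tower n :
  a ^+ n * laplace_tower mu D f 1 n a @[a --> 0^'+] --> 0.
Proof.
pose M := n.-1`!%:R * \int[mu]_(x in D) f x.
have c0 : a * M @[a --> 0^'+] --> (0 : R).
  rewrite -[X in _ --> X](mul0r M); apply: cvgM; last exact: cvg_cst.
  exact: cvg_at_right_filter.
apply: norm_cvg0; apply: (squeeze_cvgr _ (cvg_cst 0) c0).
near=> a; have a0 : 0 < a by [].
have iF : mu.-integrable D
    (EFin \o (fun x => a ^+ n * laplace_integrand f 1 n a x)).
  exact: (integrableZl mD _ (integrable_laplace_integrand n a0)).
rewrite normr_ge0 /= /laplace_tower mulrCA normrM normrX normrN1 expr1n mul1r.
rewrite -RintegralZl//; last exact: integrable_laplace_integrand.
apply: le_trans (le_normr_Rintegral _ _) _ => //.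
have -> : a * M = \int[mu]_(x in D) (n.-1`!%:R * a * f x).
  by rewrite RintegralZl// /M; ring.
apply: le_Rintegral => //.
- exact: (integrable_abse iF).
- exact: (integrableZl mD _ f_int).
- by move=> x Dx; rewrite -mulrA laplace_integrand_le.
Unshelve. all: by end_near. Qed.

End integrability.

(** Pointwise, [f x ^+ i] is at most [f x ^+ l] or [f x ^+ k], according to
whether [f x <= 1]. The lower exponent matters because the measure may be
infinite: a Levy measure is controlled from [l = 1], a probability from
[l = 0]. *)
Lemma intermediate_moment_lty {d : measure_display} {X : measurableType d}
    {R : realType} (mu : {measure set X -> \bar R}) (D : set X) (f : X -> R)
    (l i k : nat) :
  measurable D -> measurable_fun D f -> (forall x, D x -> 0 <= f x) ->
  (l <= i <= k)%N ->
  (\int[mu]_(x in D) (f x ^+ l)%:E < +oo)%E ->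
  (\int[mu]_(x in D) (f x ^+ k)%:E < +oo)%E ->
  (\int[mu]_(x in D) (f x ^+ i)%:E < +oo)%E.
Proof.
move=> mD mf f0 /andP[li ik] fl fk.
have mfX n : measurable_fun D (fun x => (f x ^+ n)%:E).
  by apply/measurable_EFinP; exact: measurable_funX.
have fX0 n x : D x -> (0 <= (f x ^+ n)%:E)%E.
  by move=> Dx; rewrite lee_fin exprn_ge0 ?f0.
apply: (@le_lt_trans _ _
    (\int[mu]_(x in D) ((f x ^+ l)%:E + (f x ^+ k)%:E))%E); last first.
  rewrite (ge0_integralD mu mD (fX0 l) (mfX l) (fX0 k) (mfX k)).
  exact: lte_add_pinfty.
apply: ge0_le_integral => //.
- exact: fX0.
- exact: emeasurable_funD.
- move=> x Dx; rewrite -EFinD lee_fin; have [f1|f1] := leP (f x) 1.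
  + by rewrite ler_wpDr ?exprn_ge0 ?f0// ler_wiXn2l ?f0.
  + by rewrite ler_wpDl ?exprn_ge0 ?f0// ler_weXn2l// ltW.
Qed.

Lemma laplace_transformE {d : measure_display} {T : measurableType d}
    {R : realType} (Q : probability T R) (zeta : {RV Q >-> R}) (a : R) :
  laplace_transform zeta a = laplace_tower Q setT zeta 0 0 a.
Proof.
rewrite /laplace_transform /mmt_gen_fun unlock /laplace_tower expr0 mul1r.
congr fine; apply: eq_integral => w _; congr (_%:E).
by rewrite /laplace_integrand mulr0 subr0 expr0 mul1r /= mulrN mulrC.
Qed.

(** The transform being the expectation of a positive random variable, it does
not vanish. This is what excludes a zero of the Laplace exponent at some
[a > 0], where the quotient [a * rho / phi a] would be 0 by convention. *)
Lemma laplace_transform_neq0 {d : measure_display} {T : measurableType d}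
    {R : realType} (Q : probability T R) (zeta : {RV Q >-> R}) (a : R) :
  (forall w, 0 <= zeta w) -> 0 < a -> laplace_transform zeta a != 0.
Proof.
move=> zeta0 a0; apply/eqP; rewrite laplace_transformE => psi0.
have iE : Q.-integrable setT (EFin \o laplace_integrand zeta 0 0 a).
  by apply: integrable_laplace_integrand_finite.
have E w : laplace_integrand zeta 0 0 a w = expR (- (a * zeta w)).
  by rewrite /laplace_integrand mulr0 subr0 expr0 mul1r.
have I0 : (\int[Q]_w `|(laplace_integrand zeta 0 0 a w)%:E| = 0)%E.
  under eq_integral do rewrite E gee0_abs ?lee_fin ?expR_ge0// -E.
  move: psi0; rewrite /laplace_tower mul1r /Rintegral => /eqP.
  by rewrite fine_eq0 ?integrable_fin_num// => /eqP.
have := I0 => /(ae_eq_integral_abs Q measurableT _).1.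
have mE : measurable_fun setT (EFin \o laplace_integrand zeta 0 0 a).
  by case/integrableP : iE.
move=> /(_ mE) [N [mN QN0 sN]].
have : (Q setT <= Q N)%E.
  apply: le_measure; rewrite ?inE// => w _; apply: sN => /= /(_ I) /eqP.
  by rewrite E eqe gt_eqF ?expR_gt0.
by rewrite QN0 probability_setT lee_fin ler10.
Qed.

(** * Recursion between the limits of the derivatives *)

Lemma mule_def_neq0_fin {R : numDomainType} (r : R) (x : \bar R) :
  r != 0 -> (r%:E *? x)%E.
Proof. by move=> r0; rewrite mule_defE eqe (negbTE r0) /= andbF. Qed.

Lemma cvge_sum_fin_num {I : Type} {F : set_system I} {FF : Filter F}
    {R : realFieldType} {J : eqType} (r : seq J) (f : J -> I -> \bar R)
    (l : J -> \bar R) :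
  (forall i, i \in r -> l i \is a fin_num) ->
  (forall i, i \in r -> f i x @[x --> F] --> l i) ->
  (\sum_(i <- r) f i x)%E @[x --> F] --> (\sum_(i <- r) l i)%E.
Proof.
elim: r => [|j r IH] l_fin fl.
  under eq_fun do rewrite big_nil; rewrite big_nil; exact: cvg_cst.
under eq_fun do rewrite big_cons; rewrite big_cons; apply: cvgeD.
- by rewrite fin_num_adde_defr// l_fin// mem_head.
- by apply: fl; rewrite mem_head.
- by apply: IH => i ir; [apply: l_fin|apply: fl]; rewrite in_cons ir orbT.
Qed.

(** In this section [u 0] plays the role of [psi] and [v 0] that of [phi]; [p]
and [q] are the limits at [0^'+] of their derivatives. *)
Section moment_recursion.
Context {R : realType}.
Variables (u v : nat -> R -> R) (p q : nat -> \bar R) (rho : R).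
Hypotheses (du : derivative_tower u) (dv : derivative_tower v).
Hypothesis uv : forall a, 0 < a -> u 0%N a * (v 0%N a / a) = rho.
Hypothesis v_small : forall i, a ^+ i * v i a @[a --> 0^'+] --> 0.
Hypothesis up : forall i, (u i a)%:E @[a --> 0^'+] --> p i.
Hypothesis vq : forall i, (v i.+1 a)%:E @[a --> 0^'+] --> q i.+1.
Hypotheses (p0 : p 0%N = 1%E) (q1 : q 1%N = rho%:E) (rho_neq0 : rho != 0).

Let g n (a : R) : R := n.+1%:R * quotient_tower v n a.

Let gq n : (g n a)%:E @[a --> 0^'+] --> q n.+1.
Proof. by apply: cvg_quotient_tower. Qed.

(** The [k.+1]-st derivative of the constant [u 0 * (v 0 / a)], multiplied by
[k.+2] so that the binomial coefficients of order [k.+2] appear. *)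
Lemma leibniz_identity k (a : R) : 0 < a ->
  k.+2%:R * u k.+1 a * g 0 a =
  - \sum_(0 <= i < k.+1) 'C(k.+2, i)%:R * u i a * g (k.+1 - i)%N a.
Proof.
move=> a0; have dg := derivative_tower_quotient dv.
have := leibniz_tower_cst du dg uv k a0.
rewrite /leibniz_tower big_ord_recr /= binn subnn mul1r => E.
apply/eqP; rewrite -addr_eq0 big_mkord; apply/eqP.
have := congr1 ( *%R k.+2%:R) E; rewrite mulr0 mulrDr mulr_sumr => kE.
rewrite -[RHS]kE addrC; congr (_ + _); last by rewrite /g mul1r mulrA.
apply: eq_bigr => i _; rewrite /g.
have ik : (i <= k.+1)%N by rewrite ltnW.
have := mul_bin_down k.+2 i; rewrite /= => /(congr1 (fun n => n%:R : R)).
rewrite !natrM subSn// => E2.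
by rewrite !mulrA E2; ring.
Qed.

Definition moment_sum k : \bar R :=
  (\sum_(0 <= i < k) 'C(k.+1, i)%:R%:E * p i * q (k.+1 - i)%N)%E.

Variable k : nat.
Hypothesis p_fin : forall i, (i < k.+1)%N -> p i \is a fin_num.
Hypothesis q_fin : forall j, (0 < j <= k.+1)%N -> q j \is a fin_num.

Let term_fin i : i \in index_iota 1 k.+1 ->
  ('C(k.+2, i)%:R%:E * p i * q (k.+2 - i)%N)%E \is a fin_num.
Proof.
rewrite mem_index_iota => /andP[i0 ik].
rewrite !fin_numM ?p_fin// q_fin// subn_gt0 ltnS ltnW//=.
by case: i i0 {ik} => // i _; rewrite subSS leq_subr.
Qed.

(** The term of index 0 is set apart: [q k.+2] may be infinite, but its factor
[u 0] tends to 1. All the other terms have finite limits, so no indeterminate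
form arises. *)
Lemma cvg_moment_sum :
  (\sum_(0 <= i < k.+1) 'C(k.+2, i)%:R * u i a * g (k.+1 - i)%N a)%:E
    @[a --> 0^'+] --> moment_sum k.+1.
Proof.
under eq_fun do rewrite -sumEFin big_ltn//.
rewrite /moment_sum big_ltn//.
apply: cvgeD.
- rewrite fin_num_adde_defl// big_seq; apply/sum_fin_numP => i ? _.
  exact: term_fin.
- rewrite bin0 !subn0 p0 !mul1e.
  under eq_fun do rewrite mul1r EFinM.
  rewrite -[q k.+2]mul1e; apply: cvgeM; last exact: gq.
  + by apply: mule_def_neq0_fin; exact: oner_neq0.
  + by rewrite -p0; exact: up.
- apply: cvge_sum_fin_num => // i i_k.
  move: (i_k) (term_fin i_k); rewrite mem_index_iota => /andP[i0 ik] _.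
  have q_fini : q (k.+2 - i)%N \is a fin_num.
    rewrite q_fin// subn_gt0 ltnS ltnW//=.
    by case: i i0 {ik i_k} => // i _; rewrite subSS leq_subr.
  under eq_fun do rewrite EFinM.
  apply: cvgeM.
  + by rewrite mule_def_fin// fin_numM// p_fin.
  + by under eq_fun do rewrite EFinM; apply: cvgeZl => //; exact: up.
  + rewrite (_ : k.+2 - i = (k.+1 - i).+1)%N ?subSn ?(ltnW ik)//; exact: gq.
Qed.

Let moment_constant :
  (- (k.+2%:R%:E * q 1)^-1)%E = (- (k.+2%:R * rho)^-1)%:E.
Proof.
by rewrite q1 -EFinM inver mulf_eq0 pnatr_eq0 (negbTE rho_neq0).
Qed.

Lemma moment_recursion :
  p k.+1 = (- (k.+2%:R%:E * q 1)^-1 * moment_sum k.+1)%E.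
Proof.
have k2 : k.+2%:R != 0 :> R by rewrite pnatr_eq0.
apply: (cvg_unique _ (up (i := k.+1))); first exact: ereal_hausdorff.
have g0 : g 0 a @[a --> 0^'+] --> rho.
  by have := @gq 0; rewrite q1 => /fine_cvgP[].
rewrite moment_constant.
have c1 : (- (k.+2%:R * g 0 a)^-1)%:E @[a --> 0^'+] -->
    (- (k.+2%:R * rho)^-1)%:E.
  apply: cvg_EFin; first exact: nearW.
  apply: cvgN; apply: cvgV; first by rewrite mulf_neq0.
  by apply: cvgM => //; exact: cvg_cst.
have cneq0 : - (k.+2%:R * rho)^-1 != 0.
  by rewrite oppr_eq0 invr_eq0 mulf_neq0.
have FF : Filter (0 : R)^'+ by typeclasses eauto.
have := cvgeM (mule_def_neq0_fin (moment_sum k.+1) cneq0) c1 cvg_moment_sum.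
move=> /(_ FF); apply: cvg_trans; apply: near_eq_cvg; near=> a.
rewrite -EFinM; congr (_%:E).
have ga0 : g 0 a != 0.
  by near: a; apply: cvgr_neq0 g0 _.
rewrite -[X in _ * X]opprK -leibniz_identity//.
have kg0 : k.+2%:R * g 0 a != 0 by rewrite (mulf_neq0 k2 ga0).
by rewrite mulrNN [X in _ * X]mulrAC (mulKf kg0).
Unshelve. all: by end_near. Qed.

(** In [moment_sum] every term but [q k.+2] is finite, and the factor in front
of the sum is a nonzero real. *)
Lemma moment_recursion_fin : (p k.+1 \is a fin_num) = (q k.+2 \is a fin_num).
Proof.
have cneq0 : - (k.+2%:R * rho)^-1 != 0.
  by rewrite oppr_eq0 invr_eq0 mulf_neq0// pnatr_eq0.
rewrite moment_recursion moment_constant /moment_sum big_ltn//.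
rewrite bin0 subn0 p0 !mul1e.
have rest_fin :
    (\sum_(1 <= i < k.+1) 'C(k.+2, i)%:R%:E * p i * q (k.+2 - i)%N)%E
      \is a fin_num.
  by rewrite big_seq; apply/sum_fin_numP => i ? _; exact: term_fin.
rewrite -(fineK rest_fin); set s := fine _.
case: (q k.+2) => [r| |].
- by rewrite -EFinD -EFinM.
- rewrite addye// mulr_infty; case: sgrP (cneq0) => // _ _.
  + by rewrite mul1e.
  + by rewrite mulN1e.
- rewrite addNye mulr_infty; case: sgrP (cneq0) => // _ _.
  + by rewrite mul1e.
  + by rewrite mulN1e.
Qed.

End moment_recursion.

Section finiteness.
Context {R : realType}.
Variables (u v : nat -> R -> R) (p q : nat -> \bar R) (rho : R).
Hypotheses (du : derivative_tower u) (dv : derivative_tower v).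
Hypothesis uv : forall a, 0 < a -> u 0%N a * (v 0%N a / a) = rho.
Hypothesis v_small : forall i, a ^+ i * v i a @[a --> 0^'+] --> 0.
Hypothesis up : forall i, (u i a)%:E @[a --> 0^'+] --> p i.
Hypothesis vq : forall i, (v i.+1 a)%:E @[a --> 0^'+] --> q i.+1.
Hypotheses (p0 : p 0%N = 1%E) (q1 : q 1%N = rho%:E) (rho_neq0 : rho != 0).

(** Strong induction: [p k] is finite with [q k.+1], through the recursion. *)
Lemma fin_num_moment k : (forall j, (0 < j <= k.+1)%N -> q j \is a fin_num) ->
  p k \is a fin_num.
Proof.
elim/ltn_ind: k => -[|k] IH q_fin; first by rewrite p0.
rewrite (moment_recursion_fin du dv uv v_small up vq p0 q1 rho_neq0).
- by apply: q_fin; rewrite leqnn.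
- move=> i ik; apply: IH => // j /andP[j0 ji]; apply: q_fin.
  by rewrite j0 (leq_trans ji)// ltnW.
- by move=> j /andP[j0 jk]; apply: q_fin; rewrite j0 (leq_trans jk).
Qed.

Lemma fin_num_exponent k : (forall i, (i < k)%N -> p i \is a fin_num) ->
  forall j, (0 < j <= k)%N -> q j \is a fin_num.
Proof.
move=> p_fin; elim/ltn_ind => -[|[|j]] IH //; first by rewrite q1.
move=> /andP[_ jk].
rewrite -(moment_recursion_fin du dv uv v_small up vq p0 q1 rho_neq0).
- exact: p_fin.
- by move=> i ij; apply: p_fin; exact: ltn_trans jk.
- move=> i /andP[i0 ij]; apply: IH => //.
  by rewrite i0 (leq_trans ij)// ltnW.
Qed.

End finiteness.

(** * The Laplace exponent *)

Section exponent_tower.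
Context {R : realType}.
Variables (c sigma : R) (nu : {measure set (measurableTypeR R) -> \bar R}).

(** The polynomial part [c a - sigma^2 a^2 / 2] of the exponent and its
derivatives. *)
Definition brownian_exponent (n : nat) (a : R) : R :=
  match n with
  | 0 => c * a - sigma ^+ 2 * a ^+ 2 / 2
  | 1 => c - sigma ^+ 2 * a
  | 2 => - sigma ^+ 2
  | _ => 0
  end.

Let D : set (measurableTypeR R) := `]0, +oo[.
Let mD : measurable D. Proof. exact: measurable_itv. Qed.
Let mid : measurable_fun D (id : measurableTypeR R -> R).
Proof. exact: measurable_id. Qed.
Let id_ge0 (x : measurableTypeR R) : D x -> 0 <= id x.
Proof. by rewrite /D /= in_itv/= andbT => /ltW. Qed.

Definition exponent_tower (n : nat) (a : R) : R :=
  brownian_exponent n a - laplace_tower nu D id 1 n a.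

Definition exponent_limit (n : nat) : \bar R :=
  ((brownian_exponent n 0)%:E - ((-1) ^+ n)%:E * levy_moment nu n)%E.

Hypothesis nu_int : nu.-integrable D (EFin \o id).

Lemma derivative_tower_brownian : derivative_tower brownian_exponent.
Proof.
move=> [|[|[|n]]] a a0 /=.
- have ? := @is_derive_exprn R 1 a.
  by apply: is_derive_eq; rewrite /GRing.scale/=; field.
- by apply: is_derive_eq; rewrite /GRing.scale/=; ring.
- exact: is_derive_cst.
- exact: is_derive_cst.
Qed.

Lemma derivative_tower_exponent : derivative_tower exponent_tower.
Proof.
move=> n a a0; apply: is_deriveB; first exact: derivative_tower_brownian.
apply: derivative_tower_laplace => // m t t0.
exact: integrable_laplace_integrand.
Qed.

Lemma cvg_brownian_exponent n :
  brownian_exponent n a @[a --> 0^'+] --> brownian_exponent n 0.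
Proof.
apply: cvg_at_right_filter; case: n => [|[|[|n]]] /=; last 2 first.
- exact: cvg_cst.
- exact: cvg_cst.
- apply: cvgB; first by apply: cvgM => //; exact: cvg_cst.
  apply: cvgM; last exact: cvg_cst.
  by apply: cvgM; [exact: cvg_cst|exact: exprn_continuous].
- by apply: cvgB; [exact: cvg_cst|apply: cvgM => //; exact: cvg_cst].
Qed.

Lemma cvg_exprM_exponent_tower n :
  a ^+ n * exponent_tower n a @[a --> 0^'+] --> 0.
Proof.
have an0 : 0 ^+ n * brownian_exponent n 0 = 0.
  by case: n => [|n]; rewrite ?expr0n/= ?mul0r//; ring.
have c1 : a ^+ n * brownian_exponent n a @[a --> 0^'+] --> (0 : R).
  rewrite -[X in _ --> X]an0; apply: cvgM; last exact: cvg_brownian_exponent.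
  by apply: cvg_at_right_filter; exact: exprn_continuous.
have c2 := cvg_exprM_laplace_tower mD mid id_ge0 nu_int n.
rewrite -[X in _ --> X](subr0 0).
under eq_fun do rewrite /exponent_tower mulrBr.
exact: cvgB.
Qed.

Lemma cvg_exponent_tower n :
  (exponent_tower n.+1 a)%:E @[a --> 0^'+] --> exponent_limit n.+1.
Proof.
have c1 : (brownian_exponent n.+1 a)%:E @[a --> 0^'+] -->
    (brownian_exponent n.+1 0)%:E.
  by apply: cvg_EFin; [exact: nearW|exact: cvg_brownian_exponent].
have c2 : (laplace_tower nu D id 1 n.+1 a)%:E @[a --> 0^'+] -->
    (((-1) ^+ n.+1)%:E * levy_moment nu n.+1)%E.
  apply: cvg_laplace_tower => //; last by rewrite mul0r.
  by move=> a a0; exact: integrable_laplace_integrand.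
under eq_fun do rewrite /exponent_tower EFinB.
apply: cvgeB => //.
Qed.

Lemma exponent_limit_fin n : (exponent_limit n \is a fin_num) =
  (levy_moment nu n \is a fin_num).
Proof.
rewrite /exponent_limit; set g := brownian_exponent n 0.
case: (levy_moment nu n) => [r| |].
- by rewrite -EFinM -EFinB.
- by rewrite -signr_odd; case: odd; rewrite ?expr1 ?expr0 ?mulN1e ?mul1e.
- by rewrite -signr_odd; case: odd; rewrite ?expr1 ?expr0 ?mulN1e ?mul1e.
Qed.

End exponent_tower.

(** * Moments of the random variable *)

Theorem theorem4 (R : realType)
  (d : measure_display) (T : measurableType d) (P : probability T R)
  (J : R -> {RV P >-> R})
  (c sigma rho : R) (nu : {measure set (measurableTypeR R) -> \bar R})
  (hsigma : 0 <= sigma)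
  (hnu : (\int[nu]_(y in `]0%R, +oo[) (Num.min 1 y)%:E < +oo)%E)
  (hJ : subordinator_plus_brownian sigma J)
  (hphi : forall a : R, 0 <= a ->
     laplace_exponent J a =
     c * a - sigma ^+ 2 * a ^+ 2 / 2
       - \int[nu]_(y in `]0, +oo[) (expR (- (a * y)) - 1))
  (hrhoE : ('E_P[J 1%R] = rho%:E)%E)
  (hrho : (c%:E + \int[nu]_(y in `]0%R, +oo[) y%:E = rho%:E)%E)
  (hrho_lt0 : rho < 0)
  (d' : measure_display) (T' : measurableType d') (Q : probability T' R)
  (zeta : {RV Q >-> R}) (hzeta : forall w, 0 <= zeta w)
  (hpsi : forall a : R, 0 < a ->
     laplace_transform zeta a =
     a * fine (deriv_lim0 (laplace_exponent J) 1) / laplace_exponent J a)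
  (k : nat) (hk : (0 < k)%N) :
  let psi_ := deriv_lim0 (laplace_transform zeta) in
  let phi_ := deriv_lim0 (laplace_exponent J) in
  ((levy_moment nu k < +oo)%E ->
     (((-1) ^+ k)%:E * 'E_Q[fun w => (zeta w ^+ k)%R] = psi_ k)%E /\
     (psi_ k =
        - (k.+1%:R%:E * phi_ 1%N)^-1 *
        \sum_(0 <= i < k) 'C(k.+1, i)%:R%:E * psi_ i * phi_ (k.+1 - i)%N)%E) /\
  (levy_moment nu k = +oo%E ->
     ('E_Q[fun w => (zeta w ^+ k)%R] = ((-1) ^+ k)%:E * psi_ k)%E /\
     (((-1) ^+ k)%:E * psi_ k = +oo)%E).
Proof.
move=> psi_ phi_.
pose D : set (measurableTypeR R) := `]0, +oo[%classic.
have mD : measurable D by exact: measurable_itv.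
have mid : measurable_fun D (id : measurableTypeR R -> R).
  exact: measurable_id.
have id_ge0 (x : measurableTypeR R) : D x -> 0 <= id x.
  by rewrite /D /= in_itv/= andbT => /ltW.
have eta1E : levy_moment nu 1 = (\int[nu]_(y in `]0%R, +oo[) y%:E)%E.
  by apply: eq_integral => y _; rewrite expr1.
have eta1 : levy_moment nu 1 \is a fin_num.
  have : rho%:E \is a fin_num by [].
  by rewrite -hrho fin_numD -eta1E => /andP[].
have nu_int : nu.-integrable D (EFin \o id).
  apply/integrableP; split; first exact/measurable_EFinP.
  have -> : (\int[nu]_(y in D) `|(EFin \o id) y| = levy_moment nu 1)%E.
    apply: eq_integral => y; rewrite inE => Dy.
    by rewrite expr1 gee0_abs// lee_fin id_ge0.
  by rewrite ltey_eq eta1.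
have rho_neq0 : rho != 0 by rewrite lt_eqF.
pose u := laplace_tower Q setT zeta 0.
pose v := exponent_tower c sigma nu.
pose p n : \bar R := (((-1) ^+ n)%:E * \int[Q]_w (zeta w ^+ n)%:E)%E.
pose q := exponent_limit c sigma nu.
have phiE a : 0 < a -> laplace_exponent J a = v 0%N a.
  move=> a0; rewrite hphi ?ltW// /v /exponent_tower /laplace_tower mul1r /=.
  congr (_ - _); apply: eq_Rintegral => y _.
  by rewrite /laplace_integrand expr0 !mul1r.
have psiE a : 0 < a -> laplace_transform zeta a = u 0%N a.
  by move=> _; exact: laplace_transformE.
have u_int n a : 0 < a ->
    Q.-integrable setT (EFin \o laplace_integrand zeta 0 n a).
  by move=> a0; apply: integrable_laplace_integrand_finite.
have du : derivative_tower u by apply: derivative_tower_laplace.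
have dv : derivative_tower v by exact: derivative_tower_exponent.
have up n : (u n a)%:E @[a --> 0^'+] --> p n.
  apply: cvg_laplace_tower => //; last by rewrite mulr0.
  by move=> a a0; exact: u_int.
have vq n : (v n.+1 a)%:E @[a --> 0^'+] --> q n.+1.
  exact: cvg_exponent_tower.
have v_small n : a ^+ n * v n a @[a --> 0^'+] --> 0.
  exact: cvg_exprM_exponent_tower.
have p0 : p 0%N = 1%E.
  rewrite /p mul1e; under eq_integral do rewrite expr0.
  by rewrite integral_cst// mul1e; exact: probability_setT.
have q1 : q 1%N = rho%:E.
  rewrite /q /exponent_limit /= mulr0 subr0 expr1 mulN1e oppeK -hrho.
  by rewrite eta1E.
have psi_p n : psi_ n = p n by apply: deriv_lim0_tower (up n).
have phi_q n : phi_ n.+1 = q n.+1 by apply: deriv_lim0_tower (vq n).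
have uv a : 0 < a -> u 0%N a * (v 0%N a / a) = rho.
  move=> a0; have an0 : a != 0 by rewrite gt_eqF.
  have := hpsi a a0; rewrite -/phi_ phi_q q1 /= => E.
  have v0 : v 0%N a != 0.
    apply/eqP => v0; have := laplace_transform_neq0 hzeta a0.
    by rewrite E phiE// v0 invr0 mulr0 eqxx.
  by rewrite -psiE// E phiE//; field; rewrite an0 v0.
have EE n : 'E_Q[fun w => (zeta w ^+ n)%R]%E = (\int[Q]_w (zeta w ^+ n)%:E)%E.
  by rewrite unlock.
have sgnK n (x : \bar R) : (((-1) ^+ n)%:E * (((-1) ^+ n)%:E * x))%E = x.
  by rewrite muleA -EFinM -exprMn mulrNN mulr1 expr1n mul1e.
have moment_ge0 n : (0 <= \int[Q]_w (zeta w ^+ n)%:E)%E.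
  by apply: integral_ge0 => w _; rewrite lee_fin exprn_ge0.
have eta_ge0 n : (0 <= levy_moment nu n)%E.
  by apply: integral_ge0 => y Dy; rewrite lee_fin exprn_ge0// id_ge0.
have p_fin n :
    (p n \is a fin_num) = (\int[Q]_w (zeta w ^+ n)%:E \is a fin_num)%E.
  apply/idP/idP => [pn|En]; last by rewrite fin_numM.
  by rewrite -(sgnK n (integral _ _ _)) fin_numM.
split.
- move=> etak.
  have q_fin j : (0 < j <= k)%N -> q j \is a fin_num.
    move=> jk; rewrite exponent_limit_fin ge0_fin_numE//.
    apply: intermediate_moment_lty jk _ _ => //.
    by have := eta1; rewrite ge0_fin_numE.
  split; first by rewrite psi_p EE.
  case: k hk etak q_fin => // k' _ _ q_fin.
  rewrite psi_p phi_q.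
  rewrite (moment_recursion du dv uv v_small up vq p0 q1 rho_neq0)//.
    congr (_ * _)%E; apply: eq_big_nat => i /andP[_ ik].
    rewrite psi_p; have -> : (k'.+2 - i = (k'.+1 - i).+1)%N.
      by rewrite subSn// ltnW.
    by rewrite phi_q.
  move=> i ik.
  apply: (fin_num_moment du dv uv v_small up vq p0 q1 rho_neq0).
  move=> j /andP[j0 ji].
  by apply: q_fin; rewrite j0 (leq_trans ji).
- move=> etak.
  (* A finite moment of order [k] would make all the moments of order less than
     [k] finite, hence also [eta_k]. *)
  have Ek : (\int[Q]_w (zeta w ^+ k)%:E = +oo)%E.
    apply: contrapT => Ek.
    have {}Ek : (\int[Q]_w (zeta w ^+ k)%:E < +oo)%E.
      by rewrite ltey; apply/eqP.
    have p_fin' i : (i < k)%N -> p i \is a fin_num.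
      move=> ik; rewrite p_fin ge0_fin_numE//.
      apply: (@intermediate_moment_lty _ _ _ _ _ _ 0 i k) => //.
      - by rewrite /= ltnW.
      - by have := p0; rewrite /p mul1e => ->; rewrite ltry.
    have := fin_num_exponent du dv uv v_small up vq p0 q1 rho_neq0 p_fin'.
    move=> /(_ k); rewrite hk leqnn => /(_ isT).
    by rewrite exponent_limit_fin etak.
  by rewrite EE psi_p /p sgnK Ek.
Qed.
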